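(* There exists exactly one twisted-isomorphism class of $f$-quandles of order $2$ that does not contain a quandle. It is affine: it is represented by the $f$-quandle defined over $\mathbb{Z}_2$ with the operation $a *_2 b \equiv a+b \pmod 2$ (and structure map $f(a)=a*_2 a$).
   Context: An $f$-quandle is a triple $(X,*,f)$ where $X$ is a set, $*$ is a binary operation on $X$ and $f:X\to X$ is a map such that: (1) $(x*y)*f(z) = (x*z)*(y*z)$ for all $x,y,z\in X$; (2) for any $x,y\in X$ there exists a unique $z\in X$ with $z*y=f(x)$; (3) $x*x=f(x)$ for all $x\in X$. Its order is $|X|$. A quandle is an $f$-quandle with $f=\mathrm{id}_X$. A morphism $\phi:(X_1,*_1,f_1)\to(X_2,*_2,f_2)$ is a map with $\phi(a*_1 b)=\phi(a)*_2\phi(b)$ and $\phi\circ f_1=f_2\circ\phi$; isomorphisms are bijective morphisms and automorphisms are isomorphisms of an $f$-quandle with itself. If $\phi$ is an automorphism of $(X,*,f)$, the twist of $(X,*,f)$ by $\phi$ is the $f$-quandle $(X,*_\phi,f_\phi)$ with $a*_\phi b=\phi(a*b)$ and $f_\phi(a)=\phi(f(a))$. Two $f$-quandles $(X,*,f)$ and $(X_0,*_0,f_0)$ are twisted-isomorphically equivalent if there is an automorphism $\phi$ of $(X,*,f)$ such that $(X,*_\phi,f_\phi)$ is isomorphic to $(X_0,*_0,f_0)$; this is an equivalence relation, and its classes are the twisted-isomorphism classes. An affine $f$-quandle is one defined over $\mathbb{Z}_n$ with an operation of the form $a*b\equiv sa+tb+r$, where $s,t,r\in\mathbb{Z}_n$.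 *)

(* Defs.v *)
From mathcomp Require Import all_boot all_order all_algebra.
From mathcomp Require Import boolp classical_sets functions cardinality.

Set Implicit Arguments.
Unset Strict Implicit.
Unset Printing Implicit Defensive.

Local Open Scope classical_set_scope.
Local Open Scope card_scope.

Record is_fquandle (X : Type) (op : X -> X -> X) (f : X -> X) : Prop :=
  IsFQuandle {
    fq_distr : forall x y z, op (op x y) (f z) = op (op x z) (op y z);
    fq_div : forall x y, exists! z, op z y = f x;
    fq_diag : forall x, op x x = f x
  }.

Record fquandle : Type := FQuandle {
  fq_car :> Type;
  fq_op : fq_car -> fq_car -> fq_car;
  fq_map : fq_car -> fq_car;
  fq_ax : is_fquandle fq_op fq_map
}.

Definition has_order (n : nat) (Q : fquandle) : Prop := [set: Q] #= `I_n.

Definition is_quandle (Q : fquandle) : Prop := @fq_map Q =1 id.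

Definition is_morphism (Q1 Q2 : fquandle) (phi : Q1 -> Q2) : Prop :=
  (forall a b, phi (fq_op a b) = fq_op (phi a) (phi b)) /\
  (forall a, phi (fq_map a) = fq_map (phi a)).

Definition is_isomorphism (Q1 Q2 : fquandle) (phi : Q1 -> Q2) : Prop :=
  is_morphism phi /\ bijective phi.

Definition isomorphic (Q1 Q2 : fquandle) : Prop :=
  exists phi : Q1 -> Q2, is_isomorphism phi.

Definition is_automorphism (Q : fquandle) (phi : Q -> Q) : Prop :=
  is_isomorphism phi.

Lemma twist_ax (Q : fquandle) (phi : Q -> Q) : is_automorphism phi ->
  is_fquandle (fun a b => phi (fq_op a b)) (fun a => phi (fq_map a)).
Proof.
case=> -[phiM phif] /bij_inj phiI; split=> [x y z|x y|x].
- by rewrite -!phiM (fq_distr (fq_ax Q)).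
- have [z [zE zU]] := fq_div (fq_ax Q) x y.
  by exists z; split=> [|z' /phiI /zU //]; rewrite zE.
- by rewrite (fq_diag (fq_ax Q)).
Qed.

Definition twist (Q : fquandle) (phi : Q -> Q) (phiA : is_automorphism phi) :
  fquandle := FQuandle (twist_ax phiA).

Definition twisted_isomorphic (Q Q0 : fquandle) : Prop :=
  exists (phi : Q -> Q) (phiA : is_automorphism phi),
    isomorphic (twist phiA) Q0.

Definition twisted_class (Q : fquandle) : fquandle -> Prop :=
  fun Q0 => twisted_isomorphic Q Q0.

Definition is_twisted_class (n : nat) (C : fquandle -> Prop) : Prop :=
  exists2 Q, has_order n Q & C = twisted_class Q.

Definition contains_quandle (C : fquandle -> Prop) : Prop :=
  exists2 Q, C Q & is_quandle Q.

(* Z_n is 'I_n, with the operation given by a congruence between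
   representatives, because 'Z_n denotes the integers mod n only for n > 1;
   there the two types agree (convertibly for a literal n).  The structure map
   is not constrained here since fq_diag forces f a = a * a. *)
Definition is_affine (Q : fquandle) : Prop :=
  exists (n : nat) (op : 'I_n -> 'I_n -> 'I_n) (f : 'I_n -> 'I_n)
         (ax : is_fquandle op f),
    Q = FQuandle ax /\
    exists s t r : 'I_n,
      forall a b, op a b = s * a + t * b + r %[mod n].

(* Main.v *)
(** The relation (1) with [y := x], [z := y] and then (3) show that [f] is
    always an endomorphism.  Hence if [f] is bijective, the twist by its inverse
    is a quandle; conversely a twist of [f] by an automorphism can be the
    identity only if [f] is bijective.  On a set with two elements a
    non-bijective [f] is constant, say [f = c], and (2), (3) then say that
    [x * y = c] exactly when [x = y], which is the operation [x + y] once
    [c] is called [0]. *)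

Require Import Defs.
From mathcomp Require Import all_boot all_order all_algebra.
From mathcomp Require Import boolp classical_sets functions cardinality.

Lemma isomorphism_id (Q : fquandle) : @is_isomorphism Q Q id.
Proof. by split; [split|exists id]. Qed.

Lemma morphism_comp (Q1 Q2 Q3 : fquandle) (g : Q2 -> Q3) (h : Q1 -> Q2) :
  is_morphism g -> is_morphism h -> is_morphism (g \o h).
Proof.
move=> [gM gf] [hM hf]; split=> [a b|a] /=.
- by rewrite hM gM.
- by rewrite hf gf.
Qed.

Lemma morphism_can (Q1 Q2 : fquandle) (g : Q1 -> Q2) (h : Q2 -> Q1) :
  cancel g h -> cancel h g -> is_morphism g -> is_morphism h.
Proof.
move=> gK hK [gM gf]; split=> [a b|a]; apply: (can_inj gK).
- by rewrite gM !hK.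
- by rewrite gf !hK.
Qed.

Lemma isomorphic_sym (Q1 Q2 : fquandle) : isomorphic Q1 Q2 -> isomorphic Q2 Q1.
Proof.
move=> [g [gM [h gK hK]]]; exists h; split; last by exists g.
exact: morphism_can gK hK gM.
Qed.

(** Conjugating the automorphism [phi] of [Q2] by [g] gives one of [Q1], and [g] is then also an
    isomorphism between the two twists. *)
Lemma isomorphic_twisted (Q1 Q2 R : fquandle) : isomorphic Q1 Q2 ->
  twisted_isomorphic Q2 R -> twisted_isomorphic Q1 R.
Proof.
move=> [g [gM [h gK hK]]] [phi [phiA [k [kM kB]]]].
have hM := morphism_can _ _ _ _ gK hK gM.
have [phiM phiB] := phiA.
have gB : bijective g by exists h.
have hB : bijective h by exists g.
have chiA : is_automorphism (Q := Q1) (h \o (phi \o g)).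
  split; first exact/(morphism_comp _ _ _ _ _ hM)/morphism_comp.
  exact/(bij_comp hB)/bij_comp.
exists (h \o (phi \o g)), chiA, (k \o g); split; last exact: bij_comp.
have [[kop kmap] [gop gmap]] := (kM, gM).
split=> [a b|a] /=; rewrite hK.
- by rewrite gop -kop.
- by rewrite gmap -kmap.
Qed.

Lemma eq_twisted_class (Q1 Q2 : fquandle) :
  isomorphic Q1 Q2 -> twisted_class Q1 = twisted_class Q2.
Proof.
move=> Q12; apply/funext => R; apply/propext; split.
- exact/isomorphic_twisted/isomorphic_sym.
- exact: isomorphic_twisted.
Qed.

Lemma fq_map_morphism (Q : fquandle) : is_morphism (@fq_map Q).
Proof.
split=> // a b.
by rewrite -(fq_diag (fq_ax Q)) -(fq_distr (fq_ax Q)) (fq_diag (fq_ax Q)).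
Qed.

Lemma contains_quandleP (Q : fquandle) :
  contains_quandle (twisted_class Q) <-> bijective (@fq_map Q).
Proof.
split=> [[R [phi [phiA [k [[_ kf] kB]]]] Rid]|[h fK hK]].
  have [_ [psi phiK psiK]] := phiA.
  (* [k] carries the structure map of the twist to that of [R], which is the identity. *)
  have fE a : phi (fq_map a) = a by apply: (bij_inj kB); rewrite kf Rid.
  exists phi => // a; apply: (can_inj phiK); exact: fE.
have hA : is_automorphism h.
  split; last by exists (@fq_map Q).
  exact: morphism_can fK hK (fq_map_morphism Q).
exists (twist hA) => //.
by exists h, hA, id; exact: isomorphism_id.
Qed.

(** [card_bijP] yields bijections between the subtypes attached to sets; [to_setT] and [set_val]
    pass between a type and its full set. *)
Lemma has_orderP (n : nat) (Q : fquandle) :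
  has_order n Q <-> exists g : Q -> 'I_n, bijective g.
Proof.
have to_setT_bij (T : Type) : bijective (@to_setT T).
  by exists set_val => [//|x]; exact: val_inj.
have set_val_bij (T : Type) : bijective (@set_val T [set: T]).
  by exists to_setT => [x|//]; exact: val_inj.
have cI : ([set: 'I_n] #= `I_n)%card by exact: card_esym card_II.
split=> [Qn|[g gB]].
  have /card_bijP[g gB] := card_eq_trans Qn (card_esym cI).
  exists (set_val \o g \o to_setT).
  exact: bij_comp (bij_comp (set_val_bij _) gB) (to_setT_bij _).
apply: card_eq_trans cI; apply/card_bijP; exists (to_setT \o g \o set_val).
exact: bij_comp (bij_comp (to_setT_bij _) gB) (set_val_bij _).
Qed.

Lemma Z2_neq (a b c : 'Z_2) : a != b -> (c == a) || (c == b).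
Proof. by case: a b c => [[|[|]]] // ? [[|[|]]] // ? [[|[|]]]. Qed.

Lemma addZ2_diag (a : 'Z_2) : (a + a = 0)%R.
Proof. by apply/eqP; case: a => [[|[|]]]. Qed.

Lemma addZ2_ax : is_fquandle (fun a b : 'Z_2 => (a + b)%R)
                             (fun a : 'Z_2 => (a + a)%R).
Proof.
have aa := addZ2_diag.
split=> // [x y z|x y].
- by rewrite aa GRing.addr0 GRing.addrACA aa GRing.addr0.
(* As 2 = 0, the equation reads z + y = 0, and its solution -y is y. *)
- exists y; split; first by rewrite !aa.
  by move=> z; rewrite aa -(aa y) => /GRing.addIr.
Qed.

Lemma addZ2_affine : is_affine (FQuandle addZ2_ax).
Proof.
exists 2, (fun a b : 'Z_2 => (a + b)%R), (fun a : 'Z_2 => (a + a)%R), addZ2_ax.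
split=> //; exists (@Ordinal 2 1 isT), (@Ordinal 2 1 isT), (@Ordinal 2 0 isT).
by move=> [[|[|]]] // ? [[|[|]]].
Qed.

Lemma fq_map_const (Q : fquandle) : has_order 2 Q -> ~ bijective (@fq_map Q) ->
  forall x y : Q, fq_map x = fq_map y.
Proof.
move=> /has_orderP[g [h gK hK]] fB.
have [a [b [ab fab]]] : exists a b : Q, a <> b /\ fq_map a = fq_map b.
  apply: contrapT => nab; apply: fB.
  have fI : injective (@fq_map Q).
    by move=> a b fab; apply: contrapT => ab; apply: nab; exists a, b.
  (* Finiteness enters here: transported to ['I_2] along [g], an injective self-map is bijective,
     and its inverse is transported back. *)
  have /injF_bij[k fK kK] : injective (g \o @fq_map Q \o h).
    by move=> i j /= /(can_inj gK)/fI/(can_inj hK).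
  exists (h \o k \o g) => x /=.
  - by apply: (can_inj gK); rewrite hK -[in RHS](fK (g x)) /= gK.
  - by apply: (can_inj gK); exact: kK.
have fa z : fq_map z = fq_map a.
  (* [g a] and [g b] exhaust ['Z_2], so every element is [a] or [b], where the structure map takes
     one value. *)
  have gab : g a != g b by apply/eqP => /(can_inj gK).
  by case/orP: (Z2_neq _ _ (g z) gab) => /eqP/(can_inj gK) ->.
by move=> x y; rewrite !fa.
Qed.

Lemma isomorphic_addZ2 (Q : fquandle) : has_order 2 Q ->
  ~ bijective (@fq_map Q) -> isomorphic Q (FQuandle addZ2_ax).
Proof.
move=> Q2 /(fq_map_const _ Q2) fC; have /has_orderP[g gB] := Q2.
have [h gK hK] := gB.
(* The constant value of the structure map; [h ord0] is merely some element of [Q]. *)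
pose c : Q := fq_map (h ord0).
have fc x : fq_map x = c by exact: fC.
have opc x y : fq_op x y = c -> x = y.
  (* By (3), [y] also solves z * y = c, so uniqueness in (2) gives x = y. *)
  move=> xy; have [z [_ zU]] := fq_div (fq_ax Q) y y.
  by rewrite -(zU x) ?fc // (zU y) // (fq_diag (fq_ax Q)).
(* The bijection [g], translated so that [c] goes to 0. *)
pose k (x : Q) : 'Z_2 := (g x - g c :> 'Z_2)%R.
have kI : injective k by move=> x y /GRing.addIr/(can_inj gK).
have kc : k c = 0%R by rewrite /k GRing.subrr.
have aa := addZ2_diag.
exists k; split.
  split=> [x y|x] /=; last by rewrite fc aa.
  have [/kI ->|xy] := eqVneq (k x) (k y).
    by rewrite (fq_diag (fq_ax Q)) fc aa.
  have : k (fq_op x y) != 0%R.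
    by rewrite -kc; apply: contra_neq xy => /kI/opc ->.
  (* A nonzero element of ['Z_2] is 1, which is also the sum of two distinct elements. *)
  by move: (k _) (k x) (k y) xy => [[|[|]]] // ? [[|[|]]] // ? [[|[|]]] // ? _ _;
    exact: val_inj.
exists (fun a : 'Z_2 => h (a + g c)%R) => [x|a].
- by rewrite /k GRing.subrK gK.
- by rewrite /k hK GRing.addrK.
Qed.

Theorem theorem3p4 :
  exists C : fquandle -> Prop,
    unique (fun D : fquandle -> Prop =>
              is_twisted_class 2 D /\ ~ contains_quandle D) C /\
    exists ax : is_fquandle (fun a b : 'Z_2 => (a + b)%R)
                            (fun a : 'Z_2 => (a + a)%R),
      C = twisted_class (FQuandle ax) /\ is_affine (FQuandle ax).
Proof.
exists (twisted_class (FQuandle addZ2_ax)); split; last first.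
  by exists addZ2_ax; split=> //; exact: addZ2_affine.
split; first split.
- exists (FQuandle addZ2_ax) => //; apply/has_orderP.
  by exists id; exists id.
(* Doubling sends both 0 and 1 to 0, so it is not injective. *)
- move=> /contains_quandleP /bij_inj fI.
  suff : (0 : 'Z_2)%R = 1%R by [].
  by apply: fI; rewrite /= !addZ2_diag.
- move=> _ [[Q Q2 ->] nq]; apply/esym/eq_twisted_class/isomorphic_addZ2 => //.
  by move/contains_quandleP.
Qed.
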